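(* Let $\mathfrak{g}=\bigoplus_{j=-r}^r\mathfrak{g}(j)$ be a graded complex simple Lie algebra with $\mathfrak{g}(1)\neq0$, let $G$ be a complex analytic group with Lie algebra $\mathfrak{g}$, and let $L$ be the analytic subgroup of $G$ with Lie algebra $\mathfrak{g}(0)$. For all $l\in L$, all $X\in\mathfrak{g}(1)$ and $0\le k\le 2r$, $$\tau_k(\mathrm{Ad}(l)X)=(\mathrm{Ad}(l)\otimes\mathrm{Ad}(l))\,\tau_k(X).$$
   Context: $\kappa$ is the Killing form. $\omega=\sum_jX_j^*\otimes X_j\in\mathfrak{g}(-r)\otimes\mathfrak{g}(r)$, where $\{X_j\}$ is a basis of $\mathfrak{g}(r)$ (e.g. of root vectors) and $\{X_j^*\}$ is the dual basis of $\mathfrak{g}(-r)$ with respect to $\kappa$, i.e. $\kappa(X_j^*,X_t)=\delta_{j,t}$ ($\omega$ does not depend on the basis). $\tau_k:\mathfrak{g}(1)\to\mathfrak{g}(-r+k)\otimes\mathfrak{g}(r)$ is defined by $\tau_k(X)=\frac{1}{k!}\big(\mathrm{ad}(X)^k\otimes\mathrm{Id}\big)\omega$. *)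

(* Defs.v *)
From HB Require Import structures.
From mathcomp Require Import all_boot all_order all_algebra.
From mathcomp Require Import all_classical all_reals all_analysis.
From mathcomp Require Import complex.

Set Implicit Arguments.
Unset Strict Implicit.
Unset Printing Implicit Defensive.

Import Order.TTheory GRing.Theory Num.Theory.
Import numFieldNormedType.Exports passmx.

Local Open Scope classical_set_scope.
Local Open Scope ring_scope.

HB.mixin Record Vector_isLieAlgebra (K : fieldType) g of Vector K g := {
  lie : g -> g -> g;
  lie_linearl : forall y, linear (lie^~ y);
  lie_linearr : forall x, linear (lie x);
  lie_alt : forall x, lie x x = 0;
  lie_jacobi : forall x y z,
    lie x (lie y z) + lie y (lie z x) + lie z (lie x y) = 0
}.

#[short(type="lieAlgType")]
HB.structure Definition LieAlgebra (K : fieldType) :=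
  { g of Vector_isLieAlgebra K g & Vector K g }.

Section LieAlgebras.
Variables (K : fieldType) (g : lieAlgType K).
Implicit Types (x y : g) (f : 'End(g)).

Definition ad x : 'End(g) := linfun (lie x).

Definition lfun_trace f : K :=
  \tr (mxof (vbasis {: g}%VS) (vbasis {: g}%VS) f).

Definition killing x y : K := lfun_trace (ad x \o ad y)%VF.

Definition lie_ideal (I : {vspace g}) := forall x y, y \in I -> lie x y \in I.

Definition simple_lie :=
  (exists x y, lie x y != 0) /\
  (forall I : {vspace g}, lie_ideal I -> I = 0%VS \/ I = {: g}%VS).

Definition lie_grading (r : nat) (gr : int -> {vspace g}) :=
  [/\ directv (\sum_(i < (2 * r).+1) gr (i%:Z - r%:Z))%VS,
      (\sum_(i < (2 * r).+1) gr (i%:Z - r%:Z))%VS = {: g}%VS,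
      forall j : int, (r < `|j|)%N -> gr j = 0%VS
    & forall (i j : int) x y, x \in gr i -> y \in gr j -> lie x y \in gr (i + j)].

End LieAlgebras.

(* The tensor product of two finite-dimensional spaces, in coordinates: the   *)
(* entry (i, j) is the coefficient on e_i (x) f_j, where e and f are the      *)
(* library's reference bases of U and V.                                      *)
Section Tensor.
Variable K : fieldType.

Definition tensor (U V : vectType K) : vectType K :=
  'M[K]_(\dim {: U}%VS, \dim {: V}%VS).

Definition tens (U V : vectType K) (u : U) (v : V) : tensor U V :=
  (rVof (vbasis {: U}%VS) u)^T *m rVof (vbasis {: V}%VS) v.

Definition tens_map (U V U' V' : vectType K) (f : 'Hom(U, U')) (h : 'Hom(V, V'))
    (t : tensor U V) : tensor U' V' :=
  (mxof (vbasis {: U}%VS) (vbasis {: U'}%VS) f)^T *m t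
    *m mxof (vbasis {: V}%VS) (vbasis {: V'}%VS) h.

Lemma tens_linearl (U V : vectType K) (v : V) : linear (fun u : U => tens u v).
Proof. by move=> a u u'; rewrite /tens !linearP/= mulmxDl -scalemxAl. Qed.

Lemma tens_linearr (U V : vectType K) (u : U) : linear (@tens U V u).
Proof. by move=> a v v'; rewrite /tens linearP/= mulmxDr -scalemxAr. Qed.

Lemma tens_map_linear (U V U' V' : vectType K) (f : 'Hom(U, U')) (h : 'Hom(V, V')) :
  linear (tens_map f h).
Proof.
by move=> a s t; rewrite /tens_map mulmxDr mulmxDl -scalemxAr -scalemxAl.
Qed.

Lemma tens_mapE (U V U' V' : vectType K) (f : 'Hom(U, U')) (h : 'Hom(V, V')) u v :
  tens_map f h (tens u v) = tens (f u) (h v).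
Proof.
rewrite /tens_map /tens !(rVof_app _ (vbasisP _)).
by rewrite trmx_mul !mulmxA.
Qed.

Lemma tens_universal (U V W : vectType K) (b : U -> V -> W) :
  (forall v, linear (b^~ v)) -> (forall u, linear (b u)) ->
  exists! h : 'Hom(tensor U V, W), forall u v, h (tens u v) = b u v.
Proof.
move=> bl br.
pose blL v : {linear U -> W} := HB.pack (b^~ v) (GRing.isLinear.Build _ _ _ _ _ (bl v)).
pose brL u : {linear V -> W} := HB.pack (b u) (GRing.isLinear.Build _ _ _ _ _ (br u)).
pose e := vbasis {: U}%VS; pose f := vbasis {: V}%VS.
pose h0 (t : tensor U V) : W := \sum_i \sum_j t i j *: b e`_i f`_j.
have h0l : linear h0.
  move=> a s t; rewrite /h0 scaler_sumr -big_split; apply: eq_bigr => i _ /=.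
  rewrite scaler_sumr -big_split; apply: eq_bigr => j _ /=.
  by rewrite !mxE scalerDl scalerA.
pose h0L : {linear _ -> _} := HB.pack h0 (GRing.isLinear.Build _ _ _ _ _ h0l).
have tensE (i : 'I_(\dim {: U}%VS)) (j : 'I_(\dim {: V}%VS)) : tens e`_i f`_j = delta_mx i j.
  by rewrite /tens !rVofE ?vbasisP// trmx_delta mul_delta_mx.
exists (linfun h0L); split=> [u v|h' h'E].
  rewrite lfunE /= /h0 [in RHS](coord_vbasis (memvf u)).
  have -> w :
      b (\sum_i coord e i u *: e`_i) w = \sum_i coord e i u *: b e`_i w.
    rewrite -[LHS]/(blL w _) linear_sum; apply: eq_bigr => i _.
    by rewrite linearZ.
  apply: eq_bigr => i _; rewrite [in RHS](coord_vbasis (memvf v)).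
  rewrite -[b _ _]/(brL e`_i _) linear_sum scaler_sumr; apply: eq_bigr => j _.
  by rewrite linearZ /= scalerA /tens !mxE big_ord1 !mxE.
apply/lfunP => t; rewrite lfunE /= /h0 [t in RHS]matrix_sum_delta linear_sum.
apply: eq_bigr => i _; rewrite linear_sum; apply: eq_bigr => j _.
by rewrite linearZ /= -tensE h'E.
Qed.

End Tensor.

Section Tau.
Variables (K : numFieldType) (g : lieAlgType K).

Definition omega d (Xs X : d.-tuple g) : tensor g g :=
  \sum_(j < d) tens (tnth Xs j) (tnth X j).

Definition tau (w : tensor g g) (k : nat) (x : g) : tensor g g :=
  k`!%:R^-1 *: tens_map (iter k (fun f => ad x \o f)%VF \1%VF) \1%VF w.

End Tau.

(* Infinitely K-differentiable maps; for K = R[i] these are the holomorphic   *)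
(* ones. Only meaningful on an open set U.                                    *)
Section Smooth.
Variable K : numFieldType.

Fixpoint diff_upto (V W : normedModType K) (k : nat) (U : set V) (f : V -> W) :=
  (forall x, U x -> differentiable f x) /\
  (if k is k'.+1 then forall v, diff_upto k' U (fun x => 'D_v f x) else True).

Definition smooth_on (V W : normedModType K) (U : set V) (f : V -> W) :=
  forall k, diff_upto k U f.

(* chart_inv is only meaningful on the image of chart_dom. *)
Record chart (T : topologicalType) (E : normedModType K) := Chart {
  chart_dom : set T;
  chart_fun :> T -> E;
  chart_inv : E -> T
}.

Definition is_chart (T : topologicalType) (E : normedModType K) (c : chart T E) :=
  [/\ open (chart_dom c), open (c @` chart_dom c),
      forall x, chart_dom c x -> chart_inv c (c x) = x,
      {within chart_dom c, continuous c}
    & {within c @` chart_dom c, continuous (chart_inv c)}].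

Definition in_charts (S T : topologicalType) (E F : normedModType K)
  (c : chart S E) (c' : chart T F) (f : S -> T) : E -> F :=
  fun u => c' (f (chart_inv c u)).

Definition is_atlas (T : topologicalType) (E : normedModType K)
    (A : set (chart T E)) :=
  [/\ forall c, A c -> is_chart c,
      forall x, exists2 c, A c & chart_dom c x
    & forall c c', A c -> A c' ->
        smooth_on (c @` (chart_dom c `&` chart_dom c')) (in_charts c c' id)].

Definition smooth_map (S T : topologicalType) (E F : normedModType K)
    (A : set (chart S E)) (B : set (chart T F)) (f : S -> T) :=
  continuous f /\
  forall c c', A c -> B c' ->
    smooth_on (c @` (chart_dom c `&` f @^-1` chart_dom c')) (in_charts c c' f).

Definition prod_chart (S T : topologicalType) (E F : normedModType K)
    (c : chart S E) (c' : chart T F) : chart (S * T)%type (E * F)%type :=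
  Chart (chart_dom c `*` chart_dom c') (fun p => (c p.1, c' p.2))
        (fun q => (chart_inv c q.1, chart_inv c' q.2)).

Definition prod_atlas (S T : topologicalType) (E F : normedModType K)
    (A : set (chart S E)) (B : set (chart T F)) :
    set (chart (S * T)%type (E * F)%type) :=
  [set prod_chart c c' | c in A & c' in B].

End Smooth.

#[short(type="topGroupType")]
HB.structure Definition TopGroup := { G of Topological G & Group G }.

Section AnalyticGroups.
Variable K : numFieldType.

(* Connected Lie groups over K; a connected Lie group is automatically second *)
(* countable.                                                                 *)
Record analytic_group := AnalyticGroup {
  ag_group :> topGroupType;
  ag_dim : nat;
  ag_atlas : set (chart ag_group 'rV[K]_ag_dim);
  ag_hausdorff : hausdorff_space ag_group;
  ag_connected : connected [set: ag_group];
  ag_atlasP : is_atlas ag_atlas;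
  ag_mul_smooth : smooth_map (prod_atlas ag_atlas ag_atlas) ag_atlas
    (fun p : ag_group * ag_group => (p.1 * p.2)%g);
  ag_inv_smooth : smooth_map ag_atlas ag_atlas (fun x : ag_group => x^-1%g)
}.

Definition chart_at (G : analytic_group) (x : G) :=
  [set c | ag_atlas c /\ chart_dom c x] : set (chart G 'rV[K]_(ag_dim G)).

(* The differential at x, with the tangent spaces at x and f x identified     *)
(* with coordinate spaces through c and c'.                                   *)
Definition tangent_map (G H : analytic_group) (c : chart G 'rV[K]_(ag_dim G))
    (c' : chart H 'rV[K]_(ag_dim H)) (f : G -> H) (x : G) :
    'Hom('rV[K]_(ag_dim G), 'rV[K]_(ag_dim H)) :=
  linfun ('d (in_charts c c' f) (c x)).

(* c is meant to be a chart at the identity. *)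
Definition Ad_chart (G : analytic_group) (c : chart G 'rV[K]_(ag_dim G)) (a : G) :
    'End('rV[K]_(ag_dim G)) :=
  tangent_map c c (fun x : G => (a * x * a^-1)%g) 1%g.

(* The bracket of the tangent space at the identity: [u, v] = (d Ad)_1(u)(v). *)
Definition tangent_bracket (G : analytic_group) (c : chart G 'rV[K]_(ag_dim G))
    (u v : 'rV[K]_(ag_dim G)) : 'rV[K]_(ag_dim G) :=
  'd (fun p => Ad_chart c (chart_inv c p) v) (c 1%g) u.

(* An identification of g with the Lie algebra of G. *)
Record lie_algebra_of (G : analytic_group) (g : lieAlgType K) := LieAlgebraOf {
  la_chart : chart G 'rV[K]_(ag_dim G);
  la_chartP : chart_at 1%g la_chart;
  la_iso : 'Hom('rV[K]_(ag_dim G), g);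
  la_iso_inj : lker la_iso = 0%VS;
  la_iso_surj : limg la_iso = {: g}%VS;
  la_iso_lie : forall u v,
    la_iso (tangent_bracket la_chart u v) = lie (la_iso u) (la_iso v)
}.

Definition Ad (G : analytic_group) (g : lieAlgType K) (th : lie_algebra_of G g)
    (a : G) : 'End(g) :=
  (la_iso th \o Ad_chart (la_chart th) a \o (la_iso th)^-1)%VF.

(* Connected immersed Lie subgroups, not necessarily closed. *)
Record analytic_subgroup (G : analytic_group) := AnalyticSubgroup {
  as_group :> analytic_group;
  as_incl : as_group -> G;
  as_inclM : {morph as_incl : x y / (x * y)%g};
  as_incl_inj : injective as_incl;
  as_incl_smooth : smooth_map (@ag_atlas as_group) (@ag_atlas G) as_incl;
  as_incl_immersion : forall x c c', chart_at x c -> chart_at (as_incl x) c' ->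
    lker (tangent_map c c' as_incl x) = 0%VS
}.

Definition sub_has_lie_algebra (G : analytic_group) (g : lieAlgType K)
    (th : lie_algebra_of G g) (L : analytic_subgroup G) (h : {vspace g}) :=
  exists2 c, chart_at (1%g : L) c &
    limg (la_iso th \o tangent_map c (la_chart th) (@as_incl G L) 1%g)%VF = h.

End AnalyticGroups.

(* Main.v *)
Require Import Defs.
From HB Require Import structures.
From mathcomp Require Import all_boot all_order all_algebra.
From mathcomp Require Import all_classical all_reals all_analysis.
From mathcomp Require Import complex.

(* If A is an automorphism of g with (A (x) A) omega = omega, then
   ad(A x)^k A = A ad(x)^k gives tau_k(A x) = (A (x) A) tau_k(x). Take
   A = Ad(l). That Ad(l) preserves the bracket follows by differentiating
   Ad(l p l^-1) Ad(l) = Ad(l) Ad(p) at p = 1. Put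
   Omega(l) = (Ad(l) (x) Ad(l)) omega. Its differential at 1 in the direction
   z of g(0) is (ad z (x) 1 + 1 (x) ad z) omega, which vanishes because X and
   Xs are dual for the invariant form kappa and ad z preserves g(r) and g(-r).
   By translation the differential of Omega vanishes everywhere, so Omega is
   constant near 1, and { l | Omega(l) = omega } is an open subgroup of the
   connected group L. *)

Set Implicit Arguments.
Unset Strict Implicit.
Unset Printing Implicit Defensive.

Import Order.TTheory GRing.Theory Num.Theory.
Import numFieldNormedType.Exports passmx.

Local Open Scope classical_set_scope.
Local Open Scope ring_scope.

(** * Differentials of maps between normed spaces and matrix spaces *)

Section Differentials.
Variable K : numFieldType.

Lemma is_diff_inj (V W : normedModType K) (f df dh : V -> W) (x : V) :
  is_diff x f df -> is_diff x f dh -> df =1 dh.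
Proof. by move=> [_ <-] [_ <-]. Qed.

(** The first-order expansion sees only values near [x], and it determines the differential. Needed
    because chart expressions agree only locally, [chart_inv] being arbitrary off the image of the
    chart. *)
Lemma near_eq_is_diff (V W : normedModType K) (f h df : V -> W) (x : V) :
  (\forall y \near x, f y = h y) -> is_diff x f df -> is_diff x h df.
Proof.
move=> fh [fd <-].
have fhx : f x = h x by apply: nbhs_singleton fh.
have dh : h \o shift x = cst (h x) + 'd f x +o_ 0 id.
  apply/eqaddoP => e e0.
  have /eqaddoP/(_ _ e0) := diff_locally fd.
  have fh0 : \forall y \near (0 : V), f (y + x) = h (y + x).
    by move: fh; rewrite (near_shift 0 x) /= subr0.
  apply: filterS2 fh0 => y fhy /=.
  by rewrite !fctE /= fhy fhx.
have E : 'd h x = 'd f x :> (V -> W) by apply: diff_unique dh; apply: diff_continuous.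
by split => //; apply/diff_locallyP; rewrite E; split => //; apply: diff_continuous.
Qed.

Lemma is_diff_sum n (V W : normedModType K) (f df : 'I_n -> V -> W) (x : V) :
  (forall i, is_diff x (f i) (df i)) ->
  is_diff x (\sum_(i < n) f i) (\sum_(i < n) df i).
Proof.
move=> fd; elim/big_rec2: _ => [|i h dh _ hd]; first exact: is_diff_cst.
exact: is_diffD.
Qed.

(** Continuity of a linear map, on which its differentiability rests, comes from the
    finite-dimensional source: expanding in the [delta_mx] writes [f] as a finite sum of coordinate
    functions times constant vectors. *)
Lemma is_diff_linear_mx m n (W : normedModType K) (f : {linear 'M[K]_(m, n) -> W}) M :
  is_diff M f f.
Proof.
have fd N : differentiable f N.
  have -> : (f : _ -> _) =
      \sum_(i < m) \sum_(k < n) (fun N : 'M[K]_(m, n) => N i k *: f (delta_mx i k)).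
    apply/funext => A; rewrite fct_sumE {1}[A]matrix_sum_delta linear_sum.
    apply: eq_bigr => i _; rewrite fct_sumE linear_sum.
    by apply: eq_bigr => k _; rewrite linearZ.
  apply: differentiable_sum => i; apply: differentiable_sum => k.
  exact/differentiableZl/differentiable_coord.
by apply: DiffDef => //; apply: diff_lin => N; apply/differentiable_continuous/fd.
Qed.

Lemma differentiable_mx m n (V : normedModType K) (f : V -> 'M[K]_(m, n)) x :
  (forall i k, differentiable (fun y => f y i k) x) -> differentiable f x.
Proof.
move=> fd.
have -> : f = \sum_(i < m) \sum_(k < n) (fun v => f v i k *: delta_mx i k).
  apply/funext => v; rewrite fct_sumE {1}[f v]matrix_sum_delta.
  by apply: eq_bigr => i _; rewrite fct_sumE.
by apply: differentiable_sum => i; apply: differentiable_sum => k; apply/differentiableZl.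
Qed.

Lemma is_diff_coord m n (V : normedModType K) (f df : V -> 'M[K]_(m, n)) x i k :
  is_diff x f df -> is_diff x (fun y => f y i k) (fun v => df v i k).
Proof.
have @coord : {linear 'M[K]_(m, n) -> K}.
  by exists (fun M : 'M[K]_(m, n) => M i k); do 2![eexists]; do ?[constructor];
     rewrite ?mxE// => ? *; rewrite ?mxE//; move=> ?; rewrite !mxE.
by move=> fd; apply: is_diff_comp fd (is_diff_linear_mx coord _).
Qed.

Lemma is_diff_mx m n (V : normedModType K) (f df : V -> 'M[K]_(m, n)) x :
  (forall i k, is_diff x (fun y => f y i k) (fun v => df v i k)) -> is_diff x f df.
Proof.
move=> fd; have dfx : differentiable f x.
  by apply: differentiable_mx => i k; have [] := fd i k.
apply: DiffDef => //; apply/funext => v; apply/matrixP => i k.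
exact: is_diff_inj (is_diff_coord i k (differentiableP dfx)) (fd i k) v.
Qed.

End Differentials.

(** * Functions with vanishing differential on a ball *)

Section ZeroDifferential.
Variables (R : realType) (K : numFieldType).
Variables (iota : {rmorphism R -> K}) (re : {additive K -> R}) (j : K).
Hypothesis iota_le : {mono iota : a b / a <= b}.
Hypothesis iota_re : forall a : K, 0 <= a -> iota (re a) = a.
Hypothesis norm_re : forall a : K, iota `|re a| <= `|a|.
Hypothesis re_eq0 : forall a : K, re a = 0 -> re (j * a) = 0 -> a = 0.

Let iota_lt : {mono iota : a b / a < b}.
Proof. by move=> a b; rewrite !lt_neqAle iota_le fmorph_eq. Qed.

Let norm_iota a : `|iota a| = iota `|a|.
Proof.
have [a0|/ltW a0] := leP 0 a.
  by rewrite !ger0_norm// -(rmorph0 iota) iota_le.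
by rewrite !ler0_norm ?rmorphN// -(rmorph0 iota) iota_le.
Qed.

(** Here [iota], [re] and [j] model the inclusion of the reals into the complex numbers, the real
    part and the imaginary unit. Along a real line the increment of [f] is of smaller order than
    [s - t], and [norm_re] passes this bound on to its real part. *)
Lemma is_diff0_is_derive_re (V : normedModType K) (f : V -> K) (x v : V) (t : R) :
  is_diff (x + iota t *: v) f 0 ->
  is_derive t 1 (fun s : R => re (f (x + iota s *: v))) 0.
Proof.
set z := x + _ => -[/diff_locally fo df0].
have {df0}fo : f \o shift z = cst (f z) +o_ 0 id.
  by rewrite [in LHS]fo df0 addr0.
(* The summand 1 keeps [N] positive when [v] is 0. *)
pose N : R := re `|v| + 1.
have nvE : `|v| = iota (re `|v|) by rewrite iota_re.
have nv0 : 0 <= re `|v| by rewrite -iota_le -nvE rmorph0.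
have N0 : 0 < N by rewrite ltr_wpDl.
have vN : `|v| <= iota N by rewrite nvE iota_le lerDl.
have D : (fun h : R => h^-1 *: (((fun s : R => re (f (x + iota s *: v))) \o shift t)
    (h *: 1) - re (f (x + iota t *: v)))) @ 0^' --> (0 : R).
  apply/cvgr0Pnorm_le => a a0.
  have aN0 : 0 < iota (a / N) by rewrite -(rmorph0 iota) iota_lt divr_gt0.
  have /eqaddoP/(_ _ aN0)/nbhs_ballP[b /= b0 Hb] := fo.
  have bE : b = iota (re b) by rewrite iota_re// ltW.
  have b0' : 0 < re b by rewrite -iota_lt -bE rmorph0.
  apply/nbhs_ballP; exists (re b / N) => /=; first by rewrite divr_gt0.
  move=> h; rewrite /ball /= sub0r normrN => hb h0.
  have nh : `|iota h *: v| <= iota (`|h| * N).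
    by rewrite normrZ rmorphM /= norm_iota; apply: ler_pM => //; rewrite -norm_iota.
  have /Hb : ball (0 : V) b (iota h *: v).
    rewrite -ball_normE /= sub0r normrN (le_lt_trans nh)// bE iota_lt.
    by rewrite -ltr_pdivlMr.
  rewrite !fctE /= => fle.
  rewrite normrZ normfV ler_pdivrMl ?normr_gt0//.
  have {}fle := le_trans fle (ler_wpM2l (ltW aN0) nh).
  have := le_trans (norm_re _) fle.
  rewrite -rmorphM iota_le raddfB /=.
  rewrite [_%:A]mulr1 (_ : iota h *: v + z = x + iota (h + t) *: v); last first.
    by rewrite /z rmorphD /= scalerDl addrCA.
  by move=> /le_trans; apply; rewrite mulrA mulrAC divfK ?gt_eqF// mulrC.
split; last exact: cvg_lim D.
by apply/cvg_ex; exists 0.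
Qed.

(** The mean value theorem is available for real functions of a real variable, so it is applied to
    [re f] on the segment from [x] to [y]. Doing the same with [j *: f] recovers the imaginary part,
    and [re_eq0] combines the two. *)
Lemma diff0_ball_cst (V : normedModType K) (f : V -> K) (x : V) (e : K) :
  (forall y, ball x e y -> is_diff y f 0) -> forall y, ball x e y -> f y = f x.
Proof.
move=> fd y xey.
pose v := y - x; pose z (t : R) := x + iota t *: v.
have zin (t : R) : 0 <= t <= 1 -> ball x e (z t).
  move=> /andP[t0 t1]; move: xey; rewrite -!ball_normE /= /z opprD addNKr.
  rewrite normrN normrZ distrC; apply: le_lt_trans.
  by rewrite ler_piMl// norm_iota ger0_norm// -(rmorph1 iota) iota_le.
have reE (h : V -> K) : (forall y, ball x e y -> is_diff y h 0) -> re (h y) = re (h x).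
  move=> hd.
  have dh (t : R) : 0 <= t <= 1 -> is_derive t 1 (fun s : R => re (h (z s))) 0.
    by move=> /zin/hd; apply: is_diff0_is_derive_re.
  have [||t _] := @MVT _ (fun s : R => re (h (z s))) (cst 0) 0 1 ltr01.
  - by move=> t; rewrite in_itv /= => /andP[t0 t1]; apply: dh; rewrite !ltW.
  - apply: derivable_within_continuous => t; rewrite in_itv /= => /dh.
    by case.
  rewrite /z rmorph0 rmorph1 scale0r addr0 scale1r /v [x + (y - x)]addrC subrK mul0r => /eqP.
  by rewrite subr_eq0 => /eqP.
apply/eqP; rewrite -subr_eq0; apply/eqP/re_eq0.
  by rewrite raddfB reE// subrr.
have /reE : forall y, ball x e y -> is_diff y (j *: f) 0.
  by move=> u /fd fu; apply: is_diff_eq; rewrite scaler0.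
by rewrite mulrBr raddfB !fctE => ->; rewrite subrr.
Qed.

End ZeroDifferential.

(* This fails over totally disconnected fields such as rat. *)
Definition zero_diff_cst (K : numFieldType) :=
  forall (V : normedModType K) (f : V -> K) (x : V) (e : K),
  (forall y, ball x e y -> is_diff y f 0) -> forall y, ball x e y -> f y = f x.

Lemma zero_diff_cst_complex (R : realType) : zero_diff_cst R[i].
Proof.
pose iota : {rmorphism R -> Num.NumField.sort R[i]} := real_complex R.
pose re : {additive (Num.NumField.sort R[i]) -> R} := @complex.Re R.
move=> V; apply: (@diff0_ball_cst R R[i] iota re 'i%C).
- by move=> a b; rewrite lecR.
- by move=> a /ger0_real/RRe_real.
- exact: normc_ge_Re.
- by move=> [a b] /= -> ; rewrite mul0r mul1r sub0r => /eqP; rewrite oppr_eq0 => /eqP ->.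
Qed.

(** * Chart expressions of maps and their chain rule *)

Section Charts.
Variable K : numFieldType.

Lemma chart_invK (T : topologicalType) (E : normedModType K) (c : chart T E) x :
  is_chart c -> chart_dom c x -> chart_inv c (c x) = x.
Proof. by move=> [_ _ + _ _]; apply. Qed.

Lemma nbhs_chart_image (T : topologicalType) (E : normedModType K) (c : chart T E) x :
  is_chart c -> chart_dom c x -> nbhs (c x) (c @` chart_dom c).
Proof. by move=> [_ oc _ _ _] cx; apply: open_nbhs_nbhs; split => //; exists x. Qed.

Lemma nbhs_chart_dom (T : topologicalType) (E : normedModType K) (c : chart T E) x :
  is_chart c -> chart_dom c x -> nbhs x (chart_dom c).
Proof. by move=> [oc _ _ _ _] cx; apply: open_nbhs_nbhs. Qed.

Lemma chart_cvg (T : topologicalType) (E : normedModType K) (c : chart T E) x :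
  is_chart c -> chart_dom c x -> c @ x --> c x.
Proof.
move=> [oc _ _ cc _] cx.
by move: cc; rewrite continuous_open_subspace// => /(_ x (mem_set cx)).
Qed.

Lemma chart_inv_cvg (T : topologicalType) (E : normedModType K) (c : chart T E) x :
  is_chart c -> chart_dom c x -> chart_inv c @ c x --> x.
Proof.
move=> cP cx; have [_ oc _ _ cc] := cP.
move: cc; rewrite continuous_open_subspace// => /(_ (c x)).
rewrite /continuous_at chart_invK//; apply.
by apply: mem_set; exists x.
Qed.

Lemma in_chartsE (S T : topologicalType) (E F : normedModType K)
    (c : chart S E) (c' : chart T F) (f : S -> T) x :
  is_chart c -> chart_dom c x -> in_charts c c' f (c x) = c' (f x).
Proof. by move=> cP cx; rewrite /in_charts chart_invK. Qed.

(** [chart_inv c'] undoes [c'] only when the intermediate point lies in [chart_dom c']; continuity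
    of [f] at [x] secures this near [c x]. *)
Lemma in_charts_comp (S T U : topologicalType) (E F H : normedModType K)
    (c : chart S E) (c' : chart T F) (c'' : chart U H) (f : S -> T) (g : T -> U) x :
  is_chart c -> is_chart c' -> chart_dom c x -> chart_dom c' (f x) ->
  {for x, continuous f} ->
  \forall u \near c x,
    in_charts c' c'' g (in_charts c c' f u) = in_charts c c'' (g \o f) u.
Proof.
move=> cP c'P cx c'fx fc.
have : nbhs (c x) ((f \o chart_inv c) @^-1` chart_dom c').
  by apply: (cvg_comp _ _ (chart_inv_cvg cP cx) fc); apply: nbhs_chart_dom.
by apply: filterS => u /= fu; rewrite /in_charts chart_invK.
Qed.

Lemma is_diff_in_charts_comp (S T U : topologicalType) (E F H : normedModType K)
    (c : chart S E) (c' : chart T F) (c'' : chart U H) (f : S -> T) (g : T -> U) x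
    df dg :
  is_chart c -> is_chart c' -> chart_dom c x -> chart_dom c' (f x) ->
  {for x, continuous f} ->
  is_diff (c x) (in_charts c c' f) df ->
  is_diff (c' (f x)) (in_charts c' c'' g) dg ->
  is_diff (c x) (in_charts c c'' (g \o f)) (dg \o df).
Proof.
move=> cP c'P cx c'fx fc fd gd.
apply: near_eq_is_diff (in_charts_comp c'' g cP c'P cx c'fx fc) _.
by apply: is_diff_comp; rewrite in_chartsE.
Qed.

Lemma is_diff_in_charts_id (T : topologicalType) (E : normedModType K)
    (c : chart T E) x :
  is_chart c -> chart_dom c x -> is_diff (c x) (in_charts c c id) id.
Proof.
move=> cP cx; apply: near_eq_is_diff (is_diff_id _).
apply: filterS (nbhs_chart_image cP cx) => _ [y cy <-].
by rewrite in_chartsE.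
Qed.

Lemma smooth_map_diff_upto (S T : topologicalType) (E F : normedModType K)
    (A : set (chart S E)) (B : set (chart T F)) (f : S -> T) c c' k :
  smooth_map A B f -> A c -> B c' ->
  diff_upto k (c @` (chart_dom c `&` f @^-1` chart_dom c')) (in_charts c c' f).
Proof. by move=> [_ +] Ac Bc'; move=> /(_ _ _ Ac Bc' k). Qed.

Lemma smooth_map_differentiable (S T : topologicalType) (E F : normedModType K)
    (A : set (chart S E)) (B : set (chart T F)) (f : S -> T) c c' x :
  smooth_map A B f -> A c -> B c' -> chart_dom c x -> chart_dom c' (f x) ->
  differentiable (in_charts c c' f) (c x).
Proof.
move=> fs Ac Bc' cx c'fx.
by have [+ _] := smooth_map_diff_upto 0 fs Ac Bc'; apply; exists x.
Qed.

(** This second order of smoothness, applied to the product of the group, is what makes [Ad]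
    differentiable. *)
Lemma smooth_map_derive_differentiable (S T : topologicalType) (E F : normedModType K)
    (A : set (chart S E)) (B : set (chart T F)) (f : S -> T) c c' x v :
  smooth_map A B f -> A c -> B c' -> chart_dom c x -> chart_dom c' (f x) ->
  differentiable (fun y => 'D_v (in_charts c c' f) y) (c x).
Proof.
move=> fs Ac Bc' cx c'fx.
have [_ /(_ v)[+ _]] := smooth_map_diff_upto 1 fs Ac Bc'.
by apply; exists x.
Qed.

End Charts.

(** * Translations and conjugation read in charts *)

Section GroupCharts.
Variables (K : numFieldType) (G : analytic_group K).
Implicit Types (a b x y : G) (c : chart G 'rV[K]_(ag_dim G)).

Lemma chart_at_is_chart x c : chart_at x c -> is_chart c.
Proof. by move=> [Ac _]; have [+ _ _] := @ag_atlasP _ G; apply. Qed.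

Lemma chart_at_dom x c : chart_at x c -> chart_dom c x.
Proof. by case. Qed.

Lemma ex_chart_at x : exists c, chart_at x c.
Proof. by have [_ /(_ x)[c] + + _] := @ag_atlasP _ G; exists c. Qed.

(** [topGroupType] imposes no compatibility between topology and group law; continuity is the first
    component of [smooth_map]. *)
Lemma mulg_cvg a b : (p.1 * p.2)%g @[p --> (a, b)] --> (a * b)%g.
Proof. by have [+ _] := @ag_mul_smooth _ G; move=> /(_ (a, b)). Qed.

Lemma mulgl_continuous a : continuous (fun x => a * x)%g.
Proof.
move=> x; apply: (@continuous2_cvg _ _ _ _ _ _ (cst a) id (fun x y => x * y)%g).
- exact: mulg_cvg.
- exact: cvg_cst.
- exact: cvg_id.
Qed.

Lemma mulgr_continuous a : continuous (fun x => x * a)%g.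
Proof.
move=> x; apply: (@continuous2_cvg _ _ _ _ _ _ id (cst a) (fun x y => x * y)%g).
- exact: mulg_cvg.
- exact: cvg_id.
- exact: cvg_cst.
Qed.

Lemma invg_continuous : continuous (fun x => x^-1)%g.
Proof. by have [] := @ag_inv_smooth _ G. Qed.

Lemma conj_continuous a : continuous (fun x => a * x * a^-1)%g.
Proof.
move=> x; apply: (@cvg_comp _ _ _ (fun x => a * x)%g (fun x => x * a^-1)%g).
  exact: mulgl_continuous.
exact: mulgr_continuous.
Qed.

Definition mul_in_charts c c' c'' := in_charts (prod_chart c c') c''
  (fun p : G * G => (p.1 * p.2)%g).

Lemma mul_in_charts_differentiable a b c c' c'' :
  chart_at a c -> chart_at b c' -> chart_at (a * b)%g c'' ->
  differentiable (mul_in_charts c c' c'') (c a, c' b).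
Proof.
move=> [Ac ca] [Ac' c'b] [Ac'' c''ab].
apply: (@smooth_map_differentiable _ _ _ _ _ _ _ _ _ _ (a, b) (@ag_mul_smooth _ G)) => //.
by exists c => //; exists c'.
Qed.

Lemma mul_in_charts_derive_differentiable a b c c' c'' v :
  chart_at a c -> chart_at b c' -> chart_at (a * b)%g c'' ->
  differentiable (fun p => 'D_v (mul_in_charts c c' c'') p) (c a, c' b).
Proof.
move=> [Ac ca] [Ac' c'b] [Ac'' c''ab].
apply: (@smooth_map_derive_differentiable _ _ _ _ _ _ _ _ _ _ (a, b) v (@ag_mul_smooth _ G)) => //.
by exists c => //; exists c'.
Qed.

(** Left translation is the product with its first coordinate frozen at [c a], so its differential
    is a partial differential of the product. *)
Lemma is_diff_mulgl a x c c' c'' :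
  chart_at a c -> chart_at x c' -> chart_at (a * x)%g c'' ->
  is_diff (c' x) (in_charts c' c'' (fun y => a * y)%g)
    (fun v => 'd (mul_in_charts c c' c'') (c a, c' x) (0, v)).
Proof.
move=> ca c'x c''ax.
have -> : in_charts c' c'' (fun y => a * y)%g =
    mul_in_charts c c' c'' \o (fun u => (c a, u)).
  apply/funext => u; rewrite /mul_in_charts /in_charts /= chart_invK//.
  - exact: chart_at_is_chart ca.
  - exact: chart_at_dom ca.
have /differentiableP dP := mul_in_charts_differentiable ca c'x c''ax.
exact: is_diff_comp (is_diff_pair (is_diff_cst (c a) (c' x)) (is_diff_id _)) dP.
Qed.

Lemma is_diff_mulgr a x c c' c'' :
  chart_at a c -> chart_at x c' -> chart_at (x * a)%g c'' ->
  is_diff (c' x) (in_charts c' c'' (fun y => y * a)%g)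
    (fun v => 'd (mul_in_charts c' c c'') (c' x, c a) (v, 0)).
Proof.
move=> ca c'x c''ax.
have -> : in_charts c' c'' (fun y => y * a)%g =
    mul_in_charts c' c c'' \o (fun u => (u, c a)).
  apply/funext => u; rewrite /mul_in_charts /in_charts /= chart_invK//.
  - exact: chart_at_is_chart ca.
  - exact: chart_at_dom ca.
have /differentiableP dP := mul_in_charts_differentiable c'x ca c''ax.
exact: is_diff_comp (is_diff_pair (is_diff_id _) (is_diff_cst (c a) (c' x))) dP.
Qed.

(** The explicit formula matters, not only differentiability: it exhibits the dependence on [a],
    which is differentiated in turn to obtain the bracket. *)
Lemma is_diff_conj a x c c' ca ca' c'' :
  chart_at x c -> chart_at a ca -> chart_at a^-1%g ca' -> chart_at (a * x)%g c'' ->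
  chart_at (a * x * a^-1)%g c' ->
  is_diff (c x) (in_charts c c' (fun y => a * y * a^-1)%g)
    (fun v => 'd (mul_in_charts c'' ca' c') (c'' (a * x)%g, ca' a^-1%g)
       ('d (mul_in_charts ca c c'') (ca a, c x) (0, v), 0)).
Proof.
move=> cx caa ca'a c''x c'x.
have dl := is_diff_mulgl caa cx c''x.
have dr := is_diff_mulgr ca'a c''x c'x.
apply: (is_diff_in_charts_comp _ _ _ _ _ dl dr).
- exact: chart_at_is_chart cx.
- exact: chart_at_is_chart c''x.
- exact: chart_at_dom cx.
- exact: chart_at_dom c''x.
- exact: mulgl_continuous.
Qed.

End GroupCharts.

(** [diff_upto] controls derivatives along constant vectors only. This expansion turns a
    differential in a varying direction [w] into derivatives along fixed directions with varying
    coefficients. *)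
Lemma linear_fst_sum (K : fieldType) n (V W : lmodType K)
    (f : {linear ('rV[K]_n * V)%type -> W}) w :
  f (w, 0) = \sum_i w 0 i *: f (delta_mx 0 i, 0).
Proof.
have -> : (w, 0 : V) = \sum_i w 0 i *: (delta_mx 0 i : 'rV[K]_n, 0 : V).
  rewrite {1}[w]row_sum_delta; apply: injective_projections => /=.
    by rewrite (raddf_sum fst).
  by rewrite (raddf_sum snd) /= big1// => i _; rewrite scaler0.
by rewrite linear_sum; apply: eq_bigr => i _; rewrite linearZ.
Qed.

(** * The adjoint representation and the bracket in a chart at the identity *)

Section AdChart.
Variables (K : numFieldType) (G : analytic_group K).
Variable c : chart G 'rV[K]_(ag_dim G).
Hypothesis c1 : chart_at 1%g c.
Implicit Types (a b x y : G) (u v : 'rV[K]_(ag_dim G)).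

Let cP : is_chart c := chart_at_is_chart c1.
Let cdom1 : chart_dom c 1%g := chart_at_dom c1.

Lemma Ad_chart_is_diff a :
  is_diff (c 1%g) (in_charts c c (fun x => a * x * a^-1)%g) (Ad_chart c a).
Proof.
have [ca caa] := ex_chart_at a; have [ca' ca'a] := ex_chart_at a^-1%g.
have [c'' c''a] := ex_chart_at (a * 1)%g.
have c1' : chart_at (a * 1 * a^-1)%g c by rewrite mulg1 mulgV.
have [d _] := is_diff_conj c1 caa ca'a c''a c1'.
by split => //; apply/funext => v; rewrite /Ad_chart /tangent_map lfunE.
Qed.

Lemma Ad_chart_val a df v :
  is_diff (c 1%g) (in_charts c c (fun x => a * x * a^-1)%g) df ->
  Ad_chart c a v = df v.
Proof. by case=> _ <-; case: (Ad_chart_is_diff a) => _ <-. Qed.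

(** Conjugation by [a * b] is a composite of conjugations, each fixing 1, so the chain rule applies
    at [c 1] with one and the same chart. *)
Lemma Ad_chartM a b v : Ad_chart c (a * b)%g v = Ad_chart c a (Ad_chart c b v).
Proof.
have E : (b * 1 * b^-1)%g = 1%g :> G by rewrite mulg1 mulgV.
have dab : is_diff (c 1%g)
    (in_charts c c ((fun x => a * x * a^-1) \o (fun x => b * x * b^-1)))%g
    (Ad_chart c a \o Ad_chart c b).
  apply: (is_diff_in_charts_comp _ _ _ _ _ (Ad_chart_is_diff b)) => //=.
  - by rewrite E.
  - exact: conj_continuous.
  - by rewrite E; apply: Ad_chart_is_diff.
have conjM : (fun x => a * b * x * (a * b)^-1)%g =
    ((fun x => a * x * a^-1) \o (fun x => b * x * b^-1))%g.
  by apply/funext => x /=; rewrite invgM !mulgA.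
move: dab; rewrite -conjM => /Ad_chart_val.
exact.
Qed.

Lemma Ad_chart1 v : Ad_chart c 1%g v = v.
Proof.
have d1 : is_diff (c 1%g) (in_charts c c (fun x => 1 * x * 1^-1)%g) id.
  have -> : (fun x : G => 1 * x * 1^-1)%g = id.
    by apply/funext => x; rewrite mul1g invg1 mulg1.
  exact: is_diff_in_charts_id.
exact: Ad_chart_val v d1.
Qed.

Let P := mul_in_charts c c c.
Let inv_c := in_charts c c (fun x : G => x^-1)%g.

(* Conjugation by a is right translation by a^-1 after left translation by a,
   so Ad(a) is expressed by first derivatives of the product P in charts, which
   are differentiable in turn. *)
Lemma Ad_chart_near v : \forall p \near c 1%g,
  Ad_chart c (chart_inv c p) v =
  \sum_i 'D_((0, v) : _ * _) P (p, c 1%g) 0 i *: 'D_((delta_mx 0 i, 0) : _ * _) P (p, inv_c p).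
Proof.
have : nbhs (c 1%g) (((fun x => x^-1)%g \o chart_inv c) @^-1` chart_dom c).
  apply: (cvg_comp _ _ (chart_inv_cvg cP cdom1) (@invg_continuous _ G 1%g)).
  by rewrite invg1; apply: nbhs_chart_dom.
apply: filterS2 (nbhs_chart_image cP cdom1) => _ [a ca <-] /=.
rewrite chart_invK// => ca'.
have caa : chart_at a c by split => //; case: c1.
have ca'a : chart_at a^-1%g c by split => //; case: c1.
have c''a : chart_at (a * 1)%g c by rewrite mulg1.
have c1' : chart_at (a * 1 * a^-1)%g c by rewrite mulg1 mulgV.
have aV : chart_at (a * a^-1)%g c by rewrite mulgV.
rewrite (Ad_chart_val v (is_diff_conj c1 caa ca'a c''a c1')).
rewrite mulg1 /inv_c in_chartsE// -/P.
have dPa : differentiable P (c a, c 1%g) by apply: mul_in_charts_differentiable.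
have dPa' : differentiable P (c a, c a^-1%g) by apply: mul_in_charts_differentiable.
have DE w : 'D_w P (c a, c 1%g) = 'd P (c a, c 1%g) w := deriveE _ dPa.
have DE' w : 'D_w P (c a, c a^-1%g) = 'd P (c a, c a^-1%g) w := deriveE _ dPa'.
rewrite DE; under eq_bigr do rewrite DE'.
exact: linear_fst_sum.
Qed.

(** In the formula of [Ad_chart_near] every factor is a first derivative of [P] along a fixed
    direction, evaluated at a point that depends differentiably on [p]. *)
Lemma Ad_chart_differentiable v :
  differentiable (fun p => Ad_chart c (chart_inv c p) v) (c 1%g).
Proof.
suff /differentiableP d : differentiable (fun p =>
    \sum_i 'D_((0, v) : _ * _) P (p, c 1%g) 0 i *:
           'D_((delta_mx 0 i, 0) : _ * _) P (p, inv_c p)) (c 1%g).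
  have near_eq := filterS (fun p => @esym _ _ _) (Ad_chart_near v).
  by have [] := near_eq_is_diff (near_eq _) d.
have c11 : chart_at (1 * 1)%g c by rewrite mulg1.
have dP w : differentiable (fun q => 'D_w P q) (c 1%g, c 1%g).
  exact: mul_in_charts_derive_differentiable.
have dI : differentiable inv_c (c 1%g).
  apply: smooth_map_differentiable (@ag_inv_smooth _ G) _ _ _ _.
  - by case: c1.
  - by case: c1.
  - by [].
  - by rewrite invg1.
(* At [p = c 1] both families of derivatives are thus evaluated at [(c 1, c 1)], where [dP]
   applies. *)
have I1 : inv_c (c 1%g) = c 1%g by rewrite /inv_c in_chartsE// invg1.
rewrite -[X in differentiable X _](fct_sumE _ _ (fun i p => _ *: _)).
apply: differentiable_sum => i.
apply: differentiable_mx => i0 k; rewrite [i0]ord1.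
under eq_fun do rewrite mxE.
apply: differentiableM.
  apply: (@differentiable_comp _ _ _ _ (fun p => 'D_((0, v) : _ * _) P (p, c 1%g))
    (fun M : 'rV[K]_(ag_dim G) => M 0 i)); last exact: differentiable_coord.
  apply: (@differentiable_comp _ _ _ _ (fun p => (p, c 1%g)) (fun q => 'D_((0, v) : _ * _) P q)).
    exact: differentiable_pair.
  exact: dP.
apply: (@differentiable_comp _ _ _ _ (fun p => 'D_((delta_mx 0 i, 0) : _ * _) P (p, inv_c p))
    (fun M : 'rV[K]_(ag_dim G) => M 0 k)); last exact: differentiable_coord.
apply: (@differentiable_comp _ _ _ _ (fun p => (p, inv_c p))
   (fun q => 'D_((delta_mx 0 i, 0) : _ * _) P q)).
  exact: differentiable_pair.
by rewrite I1; apply: dP.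
Qed.

(** Makes the ['d] in [tangent_bracket] a genuine differential, subject to the chain rule. *)
Lemma tangent_bracket_is_diff v :
  is_diff (c 1%g) (fun p => Ad_chart c (chart_inv c p) v)
    (fun u => tangent_bracket c u v).
Proof. exact: differentiableP (Ad_chart_differentiable v). Qed.

Lemma Ad_chart_bracket a u v :
  Ad_chart c a (tangent_bracket c u v) =
  tangent_bracket c (Ad_chart c a u) (Ad_chart c a v).
Proof.
pose conj x := (a * x * a^-1)%g.
have conj1 : conj 1%g = 1%g by rewrite /conj mulg1 mulgV.
have conjE : in_charts c c conj (c 1%g) = c 1%g by rewrite in_chartsE// conj1.
have dl : is_diff (c 1%g) (Ad_chart c a \o (fun p => Ad_chart c (chart_inv c p) v))
    (Ad_chart c a \o (fun u => tangent_bracket c u v)).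
  exact: is_diff_comp (tangent_bracket_is_diff v) (is_diff_linear_mx _ _).
have dr : is_diff (c 1%g)
    ((fun p => Ad_chart c (chart_inv c p) (Ad_chart c a v)) \o in_charts c c conj)
    ((fun u => tangent_bracket c u (Ad_chart c a v)) \o Ad_chart c a).
  apply: is_diff_comp (Ad_chart_is_diff a) _.
  by rewrite conjE; exact: tangent_bracket_is_diff.
(* Since [conj x * a = a * x], the map in [dr] agrees near [c 1] with the one in [dl]. Uniqueness of
   the differential then equates the two sides. *)
have {}dr : is_diff (c 1%g) (Ad_chart c a \o (fun p => Ad_chart c (chart_inv c p) v))
    ((fun u => tangent_bracket c u (Ad_chart c a v)) \o Ad_chart c a).
  apply: near_eq_is_diff dr.
  have : nbhs (c 1%g) ((conj \o chart_inv c) @^-1` chart_dom c).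
    apply: (cvg_comp _ _ (chart_inv_cvg cP cdom1) (@conj_continuous _ G a 1%g)).
    by rewrite -/(conj 1%g) conj1; apply: nbhs_chart_dom.
  apply: filterS => p /= pc.
  rewrite /in_charts (chart_invK cP pc).
  set x := chart_inv c p.
  have xE : (conj x * a = a * x)%g by rewrite /conj mulgVK.
  apply: etrans (esym (Ad_chartM _ _ _)) _.
  by rewrite xE; exact: Ad_chartM.
exact: is_diff_inj dl dr u.
Qed.

End AdChart.

(** * Bracket identities and invariance of the Killing form *)

Section KillingForm.
Variables (K : fieldType) (g : lieAlgType K).
Implicit Types (x y z : g) (f h : 'End(g)).

Definition lie_linfun x : {linear g -> g} :=
  HB.pack (lie x) (GRing.isLinear.Build _ _ _ _ _ (lie_linearr x)).

Lemma adE x y : ad x y = lie x y.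
Proof. exact: (lfunE (lie_linfun x)). Qed.

Lemma lieDl x y z : lie (x + y) z = lie x z + lie y z.
Proof. by have := lie_linearl z 1 x y; rewrite !scale1r. Qed.

Lemma lieDr x y z : lie x (y + z) = lie x y + lie x z.
Proof. exact: (linearD (lie_linfun x)). Qed.

Lemma lieNr x y : lie x (- y) = - lie x y.
Proof. exact: (linearN (lie_linfun x)). Qed.

Lemma lieC x y : lie x y = - lie y x.
Proof.
apply/eqP; rewrite -addr_eq0; apply/eqP.
by have := lie_alt (x + y); rewrite lieDl !lieDr !lie_alt add0r addr0.
Qed.

Lemma lie_lie x y z : lie (lie x y) z = lie x (lie y z) - lie y (lie x z).
Proof.
have /eqP := lie_jacobi x y z.
by rewrite (lieC z (lie x y)) subr_eq0 (lieC z x) lieNr => /eqP <-.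
Qed.

Lemma ad_lie x y : ad (lie x y) = ((ad x \o ad y) - (ad y \o ad x))%VF.
Proof.
by apply/lfunP => z; rewrite add_lfunE opp_lfunE !comp_lfunE !adE lie_lie.
Qed.

Lemma ad_linear : linear (@ad K g).
Proof.
by move=> a x y; apply/lfunP => z; rewrite add_lfunE scale_lfunE !adE lie_linearl.
Qed.

Lemma lfun_trace_linear : scalar (@lfun_trace K g).
Proof. by move=> a f h; rewrite /lfun_trace linearP /= mxtraceD mxtraceZ. Qed.

Lemma lfun_traceB f h : lfun_trace (f - h) = lfun_trace f - lfun_trace h.
Proof. by rewrite /lfun_trace linearB /= raddfB. Qed.

Lemma lfun_traceC f h : lfun_trace (f \o h)%VF = lfun_trace (h \o f)%VF.
Proof. by rewrite /lfun_trace !(mxof_comp _ _ (vbasisP _)) mxtrace_mulC. Qed.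

Lemma killing_linearr x : scalar (killing x).
Proof.
move=> a y z; rewrite /killing ad_linear comp_lfunDr -comp_lfunZr.
exact: lfun_trace_linear.
Qed.

Lemma killingC x y : killing x y = killing y x.
Proof. exact: lfun_traceC. Qed.

(** [ad] turns brackets into commutators; after expansion one product of three factors is common to
    both sides, and the other two are cyclic permutations of each other. *)
Lemma killing_lie z x y : killing (lie z x) y = - killing x (lie z y).
Proof.
rewrite /killing !ad_lie comp_lfunDl comp_lfunDr comp_lfunNl comp_lfunNr.
rewrite !lfun_traceB opprB !comp_lfunA; congr (_ - _).
by rewrite [RHS]lfun_traceC comp_lfunA.
Qed.

End KillingForm.

(** * Expansions in dual bases and infinitesimal invariance of [omega] *)

Section DualBases.
Variables (K : numFieldType) (g : lieAlgType K) (d : nat).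
Variables (V : {vspace g}) (Xs X : d.-tuple g).
Hypothesis X_basis : basis_of V X.
Hypothesis X_dual : forall j t : 'I_d, killing (tnth Xs j) (tnth X t) = (j == t)%:R.

Lemma dual_basis_sumr y : y \in V ->
  y = \sum_(t < d) killing (tnth Xs t) y *: tnth X t.
Proof.
move=> yV; rewrite {1}(coord_basis X_basis yV); apply: eq_bigr => t _.
pose kL : {scalar g} := HB.pack (killing (tnth Xs t))
  (GRing.isLinear.Build _ _ _ _ _ (killing_linearr (tnth Xs t))).
rewrite (tnth_nth 0 X); congr (_ *: _).
rewrite {2}(coord_basis X_basis yV) -[RHS]/(kL _) linear_sum.
under eq_bigr do rewrite linearZ -(tnth_nth 0 X) /= X_dual.
rewrite (bigD1 t)//= eqxx mulr1 big1 ?addr0// => i it.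
by rewrite eq_sym (negbTE it) mulr0.
Qed.

End DualBases.

Section OmegaInvariance.
Variables (K : numFieldType) (g : lieAlgType K) (d : nat).
Variables (U V : {vspace g}) (Xs X : d.-tuple g).
Hypothesis Xs_basis : basis_of U Xs.
Hypothesis X_basis : basis_of V X.
Hypothesis X_dual : forall j t : 'I_d, killing (tnth Xs j) (tnth X t) = (j == t)%:R.

Lemma dual_basis_suml y : y \in U ->
  y = \sum_(t < d) killing y (tnth X t) *: tnth Xs t.
Proof.
move=> yU; under eq_bigr do rewrite killingC.
apply: (dual_basis_sumr Xs_basis) => // j t.
by rewrite killingC X_dual eq_sym.
Qed.

(** Stability of [U] and [V] under [z] lets [lie z] of each basis vector be expanded in its own
    basis, with coefficients given by [killing]. *)
Lemma omega_invariant z :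
  (forall y, y \in U -> lie z y \in U) -> (forall y, y \in V -> lie z y \in V) ->
  \sum_(j < d) (tens (lie z (tnth Xs j)) (tnth X j) +
                tens (tnth Xs j) (lie z (tnth X j))) = 0.
Proof.
move=> zU zV; rewrite big_split /=.
have XsU j : tnth Xs j \in U by apply: (basis_mem Xs_basis); apply: mem_tnth.
have XV j : tnth X j \in V by apply: (basis_mem X_basis); apply: mem_tnth.
pose tl v : {linear g -> tensor g g} := HB.pack (fun u : g => tens u v)
  (GRing.isLinear.Build _ _ _ _ _ (tens_linearl v)).
pose tr u : {linear g -> tensor g g} := HB.pack (fun v : g => tens u v)
  (GRing.isLinear.Build _ _ _ _ _ (tens_linearr u)).
have -> : \sum_j tens (lie z (tnth Xs j)) (tnth X j) =
    \sum_j \sum_t killing (lie z (tnth Xs j)) (tnth X t) *: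
      tens (tnth Xs t) (tnth X j).
  apply: eq_bigr => j _; rewrite {1}(dual_basis_suml (zU _ (XsU j))).
  rewrite -[LHS]/(tl _ _) linear_sum; apply: eq_bigr => t _.
  by rewrite linearZ.
have -> : \sum_j tens (tnth Xs j) (lie z (tnth X j)) =
    \sum_j \sum_t killing (tnth Xs t) (lie z (tnth X j)) *:
      tens (tnth Xs j) (tnth X t).
  apply: eq_bigr => j _; rewrite {1}(dual_basis_sumr X_basis X_dual (zV _ (XV j))).
  rewrite -[LHS]/(tr _ _) linear_sum; apply: eq_bigr => t _.
  by rewrite linearZ.
(* Exchanging the indices of one double sum matches the tensors; the coefficients are then opposite
   by [killing_lie]. *)
rewrite exchange_big -big_split big1//= => t _.
rewrite -big_split big1//= => j _.
by rewrite killing_lie scaleNr addNr.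
Qed.

End OmegaInvariance.

(** * Equivariance of [tau] under automorphisms fixing [omega] *)

Lemma tens_map_sum (K : fieldType) (g : vectType K) (f h : 'End(g)) d
    (u v : 'I_d -> g) :
  tens_map f h (\sum_j tens (u j) (v j)) = \sum_j tens (f (u j)) (h (v j)).
Proof.
pose fh : {linear tensor g g -> tensor g g} := HB.pack (tens_map f h)
  (GRing.isLinear.Build _ _ _ _ _ (tens_map_linear f h)).
rewrite -[LHS]/(fh _) linear_sum; apply: eq_bigr => j _.
exact: tens_mapE.
Qed.

Lemma tens_mapZ (K : fieldType) (g : vectType K) (f h : 'End(g)) a t :
  tens_map f h (a *: t) = a *: tens_map f h t.
Proof. by rewrite /tens_map -scalemxAr -scalemxAl. Qed.

Lemma tau_equivariant (K : numFieldType) (g : lieAlgType K) (A : 'End(g)) d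
    (Xs X : d.-tuple g) k y :
  (forall x z, A (lie x z) = lie (A x) (A z)) ->
  tens_map A A (omega Xs X) = omega Xs X ->
  tau (omega Xs X) k (A y) = tens_map A A (tau (omega Xs X) k y).
Proof.
move=> Alie Aw; rewrite /tau tens_mapZ; congr (_ *: _).
(* Replacing [omega] by its image on the left side alone puts an [A] to the right of the powers of
   [ad (A y)], and the induction moves it across. *)
rewrite -{1}Aw !tens_map_sum; apply: eq_bigr => j _.
rewrite !id_lfunE; congr (tens _ _).
elim: k => [|k IHk]; first by rewrite !id_lfunE.
by rewrite !iterS !comp_lfunE !adE IHk Alie.
Qed.

Local Opaque Ad_chart tangent_bracket.

(** * The adjoint action transported to [g] *)

Section AdjointAction.
Variables (K : numFieldType) (G : analytic_group K) (g : lieAlgType K).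
Variable th : lie_algebra_of G g.
Implicit Types (a b : G) (x y : g).

Let c := la_chart th.
Let c1 : chart_at 1%g c := la_chartP th.

Lemma la_isoK : cancel (la_iso th) (la_iso th)^-1%VF.
Proof. by apply: lker0_lfunK; rewrite la_iso_inj. Qed.

Lemma la_isoVK : cancel (la_iso th)^-1%VF (la_iso th).
Proof. by move=> x; apply: limg_lfunVK; rewrite la_iso_surj memvf. Qed.

Lemma AdE a x : Ad th a x = la_iso th (Ad_chart c a ((la_iso th)^-1%VF x)).
Proof. by rewrite /Ad !comp_lfunE. Qed.

Lemma la_isoV_Ad a x : (la_iso th)^-1%VF (Ad th a x) = Ad_chart c a ((la_iso th)^-1%VF x).
Proof. exact: etrans (congr1 _ (AdE a x)) (la_isoK _). Qed.

Lemma AdM a b x : Ad th (a * b)%g x = Ad th a (Ad th b x).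
Proof.
apply: etrans (AdE _ _) _; apply: esym; apply: etrans (AdE a _) _.
apply: congr1; apply: etrans (congr1 _ (la_isoV_Ad b x)) _.
exact: esym (Ad_chartM c1 _ _ _).
Qed.

Lemma Ad1 x : Ad th 1%g x = x.
Proof.
apply: etrans (AdE _ _) _; apply: etrans (la_isoVK x).
exact: congr1 (Ad_chart1 c1 _).
Qed.

Lemma Ad_lie a x y : Ad th a (lie x y) = lie (Ad th a x) (Ad th a y).
Proof.
set u := (la_iso th)^-1%VF x; set v := (la_iso th)^-1%VF y.
have xyE : lie x y = la_iso th (tangent_bracket c u v) by rewrite la_iso_lie !la_isoVK.
apply: etrans (AdE _ _) _; rewrite xyE la_isoK (AdE a x) (AdE a y).
apply: etrans (la_iso_lie _ _ _).
exact: congr1 (Ad_chart_bracket c1 _ _ _).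
Qed.

End AdjointAction.

Local Opaque Ad.

(** * Open subgroups of a connected group *)

(** Translating the neighbourhood of 1 shows that both [H] and its complement are open. *)
Lemma connected_open_subgroup (K : numFieldType) (G : analytic_group K) (H : set G) :
  nbhs 1%g H -> (forall a b, H a -> H b -> H (a * b)%g) ->
  (forall a, H a -> H a^-1%g) -> forall a, H a.
Proof.
move=> H1 HM HV.
have Ha a : nbhs a [set x | H (a^-1 * x)%g].
  by apply: (@mulgl_continuous _ G a^-1%g a); rewrite mulVg.
suff -> : H = setT by [].
apply: (@ag_connected _ G).
- by exists 1%g; apply: nbhs_singleton.
- exists H; last by rewrite setTI.
  rewrite openE => a aH; apply: filterS (Ha a) => x /= /(HM _ _ aH).
  by rewrite mulVKg.
- exists H; last by rewrite setTI.
  (* If [x] and [a^-1 * x] lie in [H], then so does [a = x * (a^-1 * x)^-1]; hence points near an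
     [a] outside [H] stay outside. *)
  rewrite -[H]setCK; apply: open_closedC; rewrite openE => a aH.
  apply: filterS (Ha a) => x /= /HV xH Hx; apply: aH.
  by have := HM _ _ Hx xH; rewrite invgM invgK mulVKg.
Qed.

Lemma as_incl1 (K : numFieldType) (G : analytic_group K) (L : analytic_subgroup G) :
  as_incl (1%g : L) = 1%g.
Proof.
have : (as_incl (1%g : L) * as_incl (1%g : L) = as_incl (1%g : L) * 1)%g.
  by rewrite -as_inclM !mulg1.
exact: mulgI.
Qed.

(** * Invariance of [omega] under a connected subgroup *)

Section SubgroupInvariance.
Variables (K : numFieldType) (G : analytic_group K) (g : lieAlgType K).
Variables (th : lie_algebra_of G g) (L : analytic_subgroup G).
Variable cL : chart L 'rV[K]_(ag_dim L).
Hypothesis cL1 : chart_at 1%g cL.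
Variables (d : nat) (Xs X : d.-tuple g).
Implicit Types (a b : L) (x y : g).

Let c := la_chart th.
Let c1 : chart_at 1%g c := la_chartP th.
Let AdL a : 'End(g) := Ad th (as_incl a).
(** The image of [Jac] is the Lie algebra of [L] inside [g]. *)
Let Jac : 'Hom('rV[K]_(ag_dim L), g) :=
  (la_iso th \o tangent_map cL c (@as_incl _ _ L) 1%g)%VF.
Let e := vbasis {: g}%VS.
(** Typed as a matrix because [tensor g g] is declared as a bare [vectType], while differentiation
    needs a normed space. *)
Let Omega a : 'M[K]_(\dim {: g}%VS, \dim {: g}%VS) :=
  tens_map (AdL a) (AdL a) (omega Xs X).

Lemma is_diff_as_incl :
  is_diff (cL 1%g) (in_charts cL c (@as_incl _ _ L)) (tangent_map cL c (@as_incl _ _ L) 1%g).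
Proof.
have dI : differentiable (in_charts cL c (@as_incl _ _ L)) (cL 1%g).
  apply: smooth_map_differentiable (@as_incl_smooth _ _ L) _ _ _ _.
  - by case: cL1.
  - by case: c1.
  - exact: chart_at_dom cL1.
  - by rewrite as_incl1; exact: chart_at_dom c1.
by split => //; apply/funext => v; rewrite /tangent_map lfunE.
Qed.

(** The differential of [Ad] at 1 is [ad], by the definition of the bracket, here composed with the
    inclusion of [L]. Coordinates are taken since [g] carries no norm. *)
Lemma AdL_coord_is_diff x i :
  is_diff (cL 1%g) (fun q => rVof e (AdL (chart_inv cL q) x) 0 i)
    (fun u => rVof e (lie (Jac u) x) 0 i).
Proof.
pose v := (la_iso th)^-1%VF x.
pose iso : {linear _ -> _} := rVof e \o la_iso th.
have in1 : in_charts cL c (@as_incl _ _ L) (cL 1%g) = c 1%g.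
  by rewrite (in_chartsE _ _ (chart_at_is_chart cL1) (chart_at_dom cL1)) as_incl1.
have d1 : is_diff (in_charts cL c (@as_incl _ _ L) (cL 1%g))
    (fun p => Ad_chart c (chart_inv c p) v) (fun u => tangent_bracket c u v).
  by rewrite in1; exact: tangent_bracket_is_diff.
have d2 := is_diff_comp is_diff_as_incl d1.
have d3 := is_diff_coord 0 i (is_diff_comp d2 (is_diff_linear_mx iso _)).
have near_eq : \forall q \near cL 1%g,
    (iso \o ((fun p => Ad_chart c (chart_inv c p) v) \o
      in_charts cL c (@as_incl _ _ L))) q 0 i = rVof e (AdL (chart_inv cL q) x) 0 i.
  have incl_cont : {for (1%g : L), continuous (@as_incl _ _ L)}.
    by have [+ _] := @as_incl_smooth _ _ L; apply.
  have dom1 : nbhs (as_incl (1%g : L)) (chart_dom c).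
    by rewrite as_incl1; apply: nbhs_chart_dom (chart_at_is_chart c1) (chart_at_dom c1).
  have domL : nbhs (cL 1%g) ((@as_incl _ _ L \o chart_inv cL) @^-1` chart_dom c).
    exact: (cvg_comp _ _ (chart_inv_cvg (chart_at_is_chart cL1) (chart_at_dom cL1))
      incl_cont _ dom1).
  apply: filterS domL => q qc.
  rewrite /= /in_charts (chart_invK (chart_at_is_chart c1) qc).
  exact: esym (congr1 (fun y => rVof e y 0 i) (AdE _ _ _)).
apply: near_eq_is_diff near_eq _.
suff -> : (fun u => rVof e (lie (Jac u) x) 0 i) =
  (fun u => (iso \o ((fun u => tangent_bracket c u v) \o
      tangent_map cL c (@as_incl _ _ L) 1%g)) u 0 i) by [].
apply/funext => u /=.
by rewrite la_iso_lie /v la_isoVK /Jac comp_lfunE.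
Qed.

Lemma sum_tens_coord (u v : 'I_d -> g) i k :
  (\sum_j tens (u j) (v j) : 'M[K]_(\dim {: g}%VS, \dim {: g}%VS)) i k =
  \sum_j rVof e (u j) 0 i * rVof e (v j) 0 k.
Proof.
rewrite summxE; apply: eq_bigr => j _.
by rewrite /tens mxE big_ord1 mxE.
Qed.

Lemma OmegaE a : Omega a = \sum_j tens (AdL a (tnth Xs j)) (AdL a (tnth X j)).
Proof. exact: tens_map_sum. Qed.

Lemma Omega_mul a b : Omega (a * b)%g = tens_map (AdL a) (AdL a) (Omega b).
Proof.
apply: etrans (OmegaE _) _; apply: esym; apply: etrans (congr1 _ (OmegaE b)) _.
apply: etrans (tens_map_sum _ _ _ _) _; apply: eq_bigr => j _.
by rewrite /AdL as_inclM; congr tens; exact: esym (AdM _ _ _ _).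
Qed.

Lemma Omega1 : Omega 1%g = omega Xs X.
Proof.
apply: etrans (OmegaE _) _; apply: eq_bigr => j _.
by rewrite /AdL as_incl1; congr tens; exact: Ad1.
Qed.

Hypothesis Jac_invariant : forall u,
  \sum_(j < d) (tens (lie (Jac u) (tnth Xs j)) (tnth X j) +
                tens (tnth Xs j) (lie (Jac u) (tnth X j))) = 0.

Lemma Omega_is_diff1 : is_diff (cL 1%g) (Omega \o chart_inv cL) 0.
Proof.
apply: is_diff_mx => i k.
pose s x i (q : 'rV[K]_(ag_dim L)) := rVof e (AdL (chart_inv cL q) x) 0 i.
pose ds x i (u : 'rV[K]_(ag_dim L)) := rVof e (lie (Jac u) x) 0 i.
have s1 x n : s x n (cL 1%g) = rVof e x 0 n.
  rewrite /s (chart_invK (chart_at_is_chart cL1) (chart_at_dom cL1)) /AdL as_incl1.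
  by congr (rVof e _ 0 n); exact: Ad1.
have sd x n : is_diff (cL 1%g) (s x n) (ds x n) := AdL_coord_is_diff x n.
have -> : (fun q => (Omega \o chart_inv cL) q i k) =
    \sum_j (s (tnth Xs j) i * s (tnth X j) k).
  apply/funext => q; rewrite fct_sumE /=.
  apply: etrans (congr1 (fun M : 'M[K]_(_, _) => M i k) (OmegaE _)) _.
  exact: sum_tens_coord.
(* The vanishing entry of [Jac_invariant] is put into the form that the product rule yields for the
   sum of products above. *)
have -> : (fun v => (0 : 'rV[K]_(ag_dim L) -> 'M[K]_(\dim {: g}%VS, \dim {: g}%VS)) v i k) =
    \sum_j (s (tnth Xs j) i (cL 1%g) *: ds (tnth X j) k +
            s (tnth X j) k (cL 1%g) *: ds (tnth Xs j) i).
  apply/funext => u; rewrite fct_sumE.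
  have := congr1 (fun M : 'M[K]_(\dim {: g}%VS, \dim {: g}%VS) => M i k) (Jac_invariant u).
  rewrite /= big_split /= mxE !sum_tens_coord -big_split /= => E.
  apply: etrans (esym E) _; apply: eq_bigr => j _.
  by rewrite !s1 addrC; congr (_ + _); rewrite mulrC.
exact: is_diff_sum.
Qed.

(* Omega(a) = (Ad(b) (x) Ad(b)) Omega(b^-1 a) reduces this to b = 1. *)
Lemma Omega_is_diff b : chart_dom cL b -> is_diff (cL b) (Omega \o chart_inv cL) 0.
Proof.
move=> cLb.
have cLP := chart_at_is_chart cL1.
have cLb' : chart_at b cL by split => //; case: cL1.
have [cb cbb] := ex_chart_at b^-1%g.
have cLbb : chart_at (b^-1 * b)%g cL by rewrite mulVg.
have [dl _] := is_diff_mulgl cbb cLb' cLbb.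
pose T : {linear _ -> 'M[K]_(\dim {: g}%VS, \dim {: g}%VS)} := HB.pack (tens_map (AdL b) (AdL b))
  (GRing.isLinear.Build _ _ _ _ _ (tens_map_linear (AdL b) (AdL b))).
have bE : in_charts cL cL (fun a => b^-1 * a)%g (cL b) = cL 1%g.
  by rewrite (in_chartsE _ _ cLP cLb) mulVg.
have d1 : is_diff (in_charts cL cL (fun a => b^-1 * a)%g (cL b)) (Omega \o chart_inv cL) 0.
  by rewrite bE; exact: Omega_is_diff1.
have d2 := is_diff_comp (is_diff_comp (differentiableP dl) d1) (is_diff_linear_mx T _).
have near_eq : \forall q \near cL b,
    (T \o ((Omega \o chart_inv cL) \o in_charts cL cL (fun a => b^-1 * a)%g)) q =
    (Omega \o chart_inv cL) q.
  have domL : nbhs (cL b) (((fun a => b^-1 * a)%g \o chart_inv cL) @^-1` chart_dom cL).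
    apply: (cvg_comp _ _ (chart_inv_cvg cLP cLb) (@mulgl_continuous _ L b^-1%g b)).
    by apply: nbhs_chart_dom => //; exact: chart_at_dom cLbb.
  apply: filterS domL => q qc.
  rewrite /= /in_charts (chart_invK cLP qc).
  apply: etrans (esym (Omega_mul _ _)) _.
  by rewrite mulVKg.
have [d3 E] := near_eq_is_diff near_eq d2.
apply: DiffDef => //; rewrite E; apply/funext => v.
exact: (linear0 T).
Qed.

Lemma Omega_cst : zero_diff_cst K -> forall a, Omega a = omega Xs X.
Proof.
move=> diff0_cst.
have cLP := chart_at_is_chart cL1; have cL1d := chart_at_dom cL1.
apply: connected_open_subgroup => [|a b aw bw|a aw]; last 2 first.
- exact: etrans (Omega_mul a b) (etrans (congr1 _ bw) aw).
(* Writing [omega] as [Omega a] turns [Omega (a^-1)] into [Omega 1]. *)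
- apply: etrans (congr1 (tens_map _ _) (esym aw)) _.
  by apply: etrans (esym (Omega_mul _ _)) _; rewrite mulVg; exact: Omega1.
(* A ball inside the image of the chart consists of points [cL b], where [Omega_is_diff] applies;
   constancy is then obtained entry by entry. *)
have /nbhs_ballP[r /= r0 rcL] := nbhs_chart_image cLP cL1d.
have Omega_ball q : ball (cL 1%g) r q -> Omega (chart_inv cL q) = omega Xs X.
  move=> qr; rewrite -Omega1; apply/matrixP => i k.
  rewrite -(chart_invK cLP cL1d).
  apply: (diff0_cst _ (fun q => Omega (chart_inv cL q) i k) _ r) => // p /rcL[b cLb <-].
  have [dq E] := is_diff_coord i k (Omega_is_diff cLb).
  by apply: DiffDef dq _; rewrite E; apply/funext => v; rewrite [LHS]mxE.
apply: filterS2 (nbhs_chart_dom cLP cL1d) (chart_cvg cLP cL1d (nbhsx_ballx _ _ r0)).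
move=> a ca /Omega_ball.
by rewrite (chart_invK cLP ca).
Qed.

End SubgroupInvariance.

(** * Equivariance of [tau] under the subgroup with Lie algebra [gr 0] *)

Lemma tau_Ad_equivariant (K : numFieldType) (g : lieAlgType K) (r : nat)
    (gr : int -> {vspace g}) (G : analytic_group K) (th : lie_algebra_of G g)
    (L : analytic_subgroup G) (d : nat) (X Xs : d.-tuple g) (l : L) (y : g) (k : nat) :
  zero_diff_cst K -> lie_grading r gr -> sub_has_lie_algebra th L (gr 0) ->
  basis_of (gr r%:Z) X -> basis_of (gr (- r%:Z)) Xs ->
  (forall j t : 'I_d, killing (tnth Xs j) (tnth X t) = (j == t)%:R) ->
  tau (omega Xs X) k (Ad th (as_incl l) y) =
  tens_map (Ad th (as_incl l)) (Ad th (as_incl l)) (tau (omega Xs X) k y).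
Proof.
move=> diff0_cst [_ _ _ gr_lie] [cL cL1 imgL] X_basis Xs_basis X_dual.
apply: tau_equivariant; first exact: Ad_lie.
apply: (Omega_cst cL1) => // u.
(* The vector [Jac u] lies in [gr 0], and a bracket with a degree 0 element preserves both [gr r]
   and [gr (- r)]. *)
have z0 := memv_img (la_iso th \o tangent_map cL (la_chart th) (@as_incl _ _ L) 1%g)%VF
  (memvf u).
rewrite imgL in z0.
by apply: (omega_invariant Xs_basis X_basis X_dual) => w /(gr_lie _ _ _ _ z0);
  rewrite add0r.
Qed.

Theorem lemma3p3 (R : realType) (g : lieAlgType R[i]) (r : nat)
    (gr : int -> {vspace g})
    (g_simple : simple_lie g) (g_graded : lie_grading r gr)
    (g1_neq0 : gr 1 != 0%VS)
    (G : analytic_group R[i]) (th : lie_algebra_of G g)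
    (L : analytic_subgroup G) (L_lie : sub_has_lie_algebra th L (gr 0))
    (d : nat) (X Xs : d.-tuple g)
    (X_basis : basis_of (gr r%:Z) X) (Xs_basis : basis_of (gr (- r%:Z)) Xs)
    (X_dual : forall j t : 'I_d, killing (tnth Xs j) (tnth X t) = (j == t)%:R)
    (l : L) (Y : g) (Y_g1 : Y \in gr 1) (k : nat) (k_le : (k <= 2 * r)%N) :
  tau (omega Xs X) k (Ad th (as_incl l) Y) =
  tens_map (Ad th (as_incl l)) (Ad th (as_incl l)) (tau (omega Xs X) k Y).
Proof.
exact: (tau_Ad_equivariant _ _ _ (@zero_diff_cst_complex R) g_graded L_lie).
Qed.
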